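(* Let $(W,S)$ be a Coxeter group with length function $|\cdot|$. For every even (resp. odd) integer $n\ge 1$ there is a unique $n$-cocycle $\epsilon^W_n\in Z^n(W,\mathbb{Z})$ (resp. $\epsilon^W_n\in Z^n(W,\mathbb{F}_2)$) satisfying the following two conditions: (1) if $n\ge 2$ and $(x_1,\dots,x_n)\in W^n$ satisfies $|x_ix_{i+1}|=|x_i|+|x_{i+1}|$ for some $1\le i\le n-1$, then $\epsilon^W_n(x_1,\dots,x_n)=0$; (2) for every $s\in S$, $\epsilon^W_n(s,s,\dots,s)=1$.
   Context: $|\cdot|:W\to\mathbb{Z}_{\ge 0}$ is the length function with respect to $S$. $W$ acts trivially on $\mathbb{Z}$ and $\mathbb{F}_2$. For a $\mathbb{Z}[W]$-module $A$, $Z^n(W,A)$ is the group of inhomogeneous $n$-cocycles, i.e. functions $\zeta:W^n\to A$ with $\delta\zeta=0$, where $(\delta\zeta)(x_1,\dots,x_{n+1})=x_1\zeta(x_2,\dots,x_{n+1})+\sum_{j=1}^n(-1)^j\zeta(x_1,\dots,x_jx_{j+1},\dots,x_{n+1})+(-1)^{n+1}\zeta(x_1,\dots,x_n)$. *)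

(* Defs.v *)
From HB Require Import structures.
From mathcomp Require Import all_boot all_order all_algebra.
From mathcomp Require Import boolp classical_sets.
Set Implicit Arguments.
Unset Strict Implicit.
Unset Printing Implicit Defensive.
Import GRing.Theory.

Local Open Scope group_scope.

Section Presentations.
Variable I : Type.

(* The letter (i, false) stands for the generator i, (i, true) for its
   inverse. *)
Definition word := seq (I * bool).

(* Two words are related iff they are equal in the quotient of the free group
   on I by the normal closure of the relators R. *)
Inductive word_eq (R : set word) : word -> word -> Prop :=
| word_eq_refl u : word_eq R u u
| word_eq_sym u v : word_eq R u v -> word_eq R v u
| word_eq_trans u v w : word_eq R u v -> word_eq R v w -> word_eq R u w
| word_eq_cancel u i b v :
    word_eq R (u ++ [:: (i, b); (i, ~~ b)] ++ v) (u ++ v)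
| word_eq_relator u r v : R r -> word_eq R (u ++ r ++ v) (u ++ v).

Definition word_eval (G : groupType) (g : I -> G) (w : word) : G :=
  \prod_(l <- w) (if l.2 then (g l.1)^-1 else g l.1).

(* The generators g and the relators R form a presentation of G: evaluation
   of words induces an isomorphism from <I | R> onto G. *)
Definition presents (R : set word) (G : groupType) (g : I -> G) : Prop :=
  (forall x : G, exists w, word_eval g w = x) /\
  (forall u v, word_eval g u = word_eval g v <-> word_eq R u v).

(* The value 0 encodes an infinite entry. *)
Definition coxeter_matrix (m : I -> I -> nat) : Prop :=
  [/\ forall s, m s s = 1%N,
      forall s t, m s t = m t s
    & forall s t, s <> t -> m s t = 0%N \/ (2 <= m s t)%N].

(* The relators (s t)^(m s t); an infinite entry gives the empty word, hence
   no relation. *)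
Definition coxeter_relators (m : I -> I -> nat) : set word :=
  [set r | exists s t,
     r = flatten (nseq (m s t) [:: (s, false); (t, false)])]%classic.

End Presentations.

Definition coxeter_group (W : groupType) (S : set W) : Prop :=
  exists m : S -> S -> nat,
    coxeter_matrix m /\ presents (coxeter_relators m) (fun s : S => val s).

(* Inverses of elements of S are not needed as letters: in a Coxeter group,
   the elements of S are involutions. *)
Definition is_word_length (W : groupType) (S : set W) (w : W) (k : nat) : Prop :=
  exists u : seq S, size u = k /\ \prod_(s <- u) val s = w.

(* The default value 0 is only used if w is not a product of elements of S. *)
Definition length (W : groupType) (S : set W) (w : W) : nat :=
  xget 0%N [set k | is_word_length S w k /\
                    forall l, is_word_length S w l -> (k <= l)%N]%classic.

Section Cochains.
Variables (W : groupType) (A : zmodType).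

(* With 0-based indices, multiplies the entries j and j + 1 of x;
   lift ord_max i and lift ord0 i are i and i + 1 as indices of x. *)
Definition merge n (j : 'I_n) (x : n.+1.-tuple W) : n.-tuple W :=
  [tuple if (i < j)%N then tnth x (lift ord_max i)
         else if i == j then tnth x (lift ord_max i) * tnth x (lift ord0 i)
         else tnth x (lift ord0 i) | i < n].

Definition drop_first n (x : n.+1.-tuple W) : n.-tuple W :=
  [tuple tnth x (lift ord0 i) | i < n].

Definition drop_last n (x : n.+1.-tuple W) : n.-tuple W :=
  [tuple tnth x (lift ord_max i) | i < n].

(* act is the action of W on A. *)
Definition coboundary (act : W -> A -> A) n (z : n.-tuple W -> A) :
    n.+1.-tuple W -> A := fun x =>
  (act (tnth x ord0) (z (drop_first x))
   + \sum_(j < n) z (merge j x) *~ (-1) ^+ j.+1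
   + z (drop_last x) *~ (-1) ^+ n.+1)%R.

Definition cocycle (act : W -> A -> A) n (z : n.-tuple W -> A) : Prop :=
  coboundary act z = (fun=> 0%R).

Definition trivial_action : W -> A -> A := fun _ a => a.

Definition vanishes_on_reduced (S : set W) n (z : n.-tuple W -> A) : Prop :=
  (2 <= n)%N ->
  forall x : n.-tuple W,
    (exists i j : 'I_n, j = i.+1 :> nat /\
       length S (tnth x i * tnth x j) =
         (length S (tnth x i) + length S (tnth x j))%N) ->
    z x = 0%R.

End Cochains.

Definition normalized (W : groupType) (A : pzRingType) (S : set W) n
    (z : n.-tuple W -> A) : Prop :=
  forall s : W, S s -> z [tuple s | _ < n] = 1%R.

(* Main.v *)
Require Import Defs.
From mathcomp Require Import all_boot all_order all_algebra.
From mathcomp Require Import boolp classical_sets.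
From mathcomp Require Import ring.

(** The cocycle counts walls. To (x_1, ..., x_n) attach the gallery of chambers
    g_k = x_1 ... x_k, for 0 <= k <= n. The value of the cocycle is the number
    of reflections t of W whose wall separates g_k from g_(k+1) for every
    k < n: the gallery crosses the wall at each of its steps. For n = 2 this is
    (|x_1| + |x_2| - |x_1 x_2|) / 2, and for n = 1 it is |x_1|, read modulo 2.

    Walls come from the presentation. The word s_1 ... s_k crosses the walls of
    the reflections (s_1 ... s_(i-1)) s_i (s_1 ... s_(i-1))^-1. The parity with
    which a given reflection occurs in this list is unchanged by the Coxeter
    relations, so it depends only on the value x of the word
    ([odd_count_eval]), and it tells whether the wall separates 1 from x.
    The list of a reduced word has no repetition ([inversions_uniq]), so
    exactly |x| walls separate 1 from x. Hence |xy| = |x| + |y| if and only if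
    no wall is crossed both from 1 to x and from x to xy, which gives condition
    (1) ([coxeter_cochain_reduced]).

    The cocycle condition holds wall by wall. Deleting one term from a sequence
    of n + 2 sides and asking whether the rest alternates gives an alternating
    sum equal to 1 + (-1)^(n+1) if the sequence alternates, and to 0 otherwise
    ([alternating_sum]). This vanishes in Z for n even and in F_2 for n odd.

    For uniqueness, let z be the difference of two solutions, so that z
    vanishes on reduced tuples and on (s, ..., s). By descending induction on
    k >= 1, z vanishes on every tuple that starts with k copies of a generator
    s: if the next entry x is not reduced after s, then x = sy with
    |x| = |y| + 1, and in the coboundary of z at (s, ..., s, y, ...), with
    k + 1 copies of s, all terms but the value of z at (s, ..., s, x, ...) are
    known to vanish ([vanish_prefix]). The same coboundary with k = 0 then
    allows an induction on the length of the first entry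
    ([vanish_everywhere]). *)

Set Implicit Arguments.
Unset Strict Implicit.
Unset Printing Implicit Defensive.
Import GRing.Theory.

Local Open Scope group_scope.

(** * Words and their reflections *)

Section Words.
Variables (W : groupType) (S : set W).
Implicit Types (u v : seq S) (t x y : W).

Definition eval u : W := \prod_(s <- u) val s.

(** The reflections s_1, s_1 s_2 s_1^-1, s_1 s_2 s_3 (s_1 s_2)^-1, ... whose walls
    are crossed in turn by the gallery of the word s_1 s_2 s_3 ... *)
Fixpoint reflections u : seq W :=
  if u is s :: v then val s :: [seq t ^ (val s)^-1 | t <- reflections v]
  else [::].

Lemma eval_nil : eval [::] = 1.
Proof. exact: big_nil. Qed.

Lemma eval_cons s u : eval (s :: u) = val s * eval u.
Proof. by rewrite /eval big_cons. Qed.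

Lemma eval_cat u v : eval (u ++ v) = eval u * eval v.
Proof. by rewrite /eval big_cat. Qed.

Lemma size_reflections u : size (reflections u) = size u.
Proof. by elim: u => //= s u IHu; rewrite size_map IHu. Qed.

Lemma reflections_cat u v :
  reflections (u ++ v) =
    reflections u ++ [seq t ^ (eval u)^-1 | t <- reflections v].
Proof.
elim: u => [|s u IHu] /=.
  rewrite -[LHS]map_id; apply: eq_map => t.
  by rewrite eval_nil invg1 conjg1.
rewrite IHu map_cat -map_comp; congr (_ :: _ ++ _); apply: eq_map => t /=.
by rewrite eval_cons invgM conjgM.
Qed.

Lemma count_conjg r x t :
  count_mem t [seq h ^ x^-1 | h <- r] = count_mem (t ^ x) r.
Proof.
rewrite count_map; apply: eq_count => h /=.
by rewrite -(inj_eq (@conjg_inj _ x)) conjgKV.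
Qed.

Lemma count_reflections_cat u v t :
  count_mem t (reflections (u ++ v)) =
    (count_mem t (reflections u) + count_mem (t ^ eval u)%g (reflections v))%N.
Proof. by rewrite reflections_cat count_cat count_conjg. Qed.

End Words.

(** * Walls separating two elements of a Coxeter group *)

Section CoxeterGroup.
Variables (W : groupType) (S : set W) (m : S -> S -> nat).
Hypothesis mxm : coxeter_matrix m.
Hypothesis prm : presents (coxeter_relators m) (fun s : S => val s).
Implicit Types (u v : seq S) (s : S) (t x y : W).

Let R := coxeter_relators m.

Lemma gen_mul s : val s * val s = 1.
Proof.
have [m1 _ _] := mxm.
have e : word_eq R ([::] ++ [:: (s, false); (s, false)] ++ [::])
                    ([::] ++ [::]).
  by apply: word_eq_relator; exists s, s; rewrite m1.
move/(proj2 prm): e.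
by rewrite /word_eval !big_cons big_nil /= mulg1.
Qed.

Lemma gen_inv s : (val s)^-1 = val s.
Proof. exact: mulg1_eq (gen_mul s). Qed.

Lemma gen_conj s : val s ^ (val s)^-1 = val s.
Proof. by rewrite gen_inv conjgE gen_mul mulg1 gen_inv. Qed.

Lemma gen_mulK s x : val s * (val s * x) = x.
Proof. by rewrite mulgA gen_mul mul1g. Qed.

(** As the generators are involutions, the signs of the letters of a word can
    be ignored. *)
Lemma word_eval_unsigned (w : word S) :
  word_eval (fun s : S => val s) w = eval (unzip1 w).
Proof.
rewrite /word_eval /eval big_map; apply: eq_bigr => -[s b] _ /=.
by case: b => //; rewrite gen_inv.
Qed.

Lemma eval_surj x : exists u, eval u = x.
Proof.
have [w <-] := (proj1 prm) x.
by exists (unzip1 w); rewrite word_eval_unsigned.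
Qed.

Lemma reflections_braid s s' k :
  reflections (unzip1 (flatten (nseq k [:: (s, false); (s', false)])))
  = [seq (val s * val s') ^+ i * val s | i <- iota 0 k.*2].
Proof.
elim: k => //= k ->; rewrite expg0 mul1g expg1; congr [:: _, _ & _].
  by rewrite gen_inv conjgE gen_inv mulgA.
rewrite -map_comp (iotaDl 2 0) -!map_comp; apply: eq_map => i /=.
rewrite conjgE [(_ ^+ i * _) ^ _]conjgE !gen_inv expgSr expgS.
by rewrite !mulgA.
Qed.

(** The reflections of the word (s s')^k are (s s')^i s for i < 2k. As
    (s s')^k = 1 in W, the second half of this list repeats the first. *)
Lemma odd_count_relator r t :
  R r -> odd (count_mem t (reflections (unzip1 r))) = false.
Proof.
move=> Rr; have e : word_eq R ([::] ++ r ++ [::]) ([::] ++ [::]).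
  exact: word_eq_relator.
move/(proj2 prm): e; rewrite cats0 /= !word_eval_unsigned /=.
case: Rr => s [s' ->]; set k := m s s'; rewrite reflections_braid => e.
have pk : (val s * val s') ^+ k = 1.
  rewrite -(eval_nil S) -e; elim: (k) => [|j IHj] /=.
    by rewrite eval_nil.
  by rewrite expgS IHj !eval_cons mulgA.
have -> : iota 0 k.*2 = iota 0 k ++ [seq (k + i)%N | i <- iota 0 k].
  by rewrite -iotaDl addn0 -addnn iotaD add0n.
rewrite map_cat count_cat -map_comp.
rewrite [X in (_ + count_mem t X)%N]
  (eq_map (g := fun i => (val s * val s') ^+ i * val s)).
  by rewrite addnn odd_double.
by move=> i /=; rewrite expgnDr pk mul1g.
Qed.

Lemma word_eq_eval (w1 w2 : word S) :
  word_eq R w1 w2 -> eval (unzip1 w1) = eval (unzip1 w2).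
Proof. by rewrite -!word_eval_unsigned => /(proj2 prm). Qed.

Lemma odd_count_word_eq (w1 w2 : word S) t : word_eq R w1 w2 ->
  odd (count_mem t (reflections (unzip1 w1)))
  = odd (count_mem t (reflections (unzip1 w2))).
Proof.
have drop_trivial (a b c : word S) :
    word_eq R b [::] ->
    (forall h, odd (count_mem h (reflections (unzip1 b))) = false) ->
    odd (count_mem t (reflections (unzip1 (a ++ b ++ c))))
    = odd (count_mem t (reflections (unzip1 (a ++ c)))).
  move=> /word_eq_eval b1 oddb; rewrite /unzip1 !map_cat.
  rewrite !count_reflections_cat !oddD oddb /=; congr (_ (+) odd (count_mem _ _)).
  by rewrite b1 eval_nil conjg1.
elim=> {w1 w2} [//|//|w1 w2 w3 _ -> //|a s b c|a r c Rr].
  apply: drop_trivial => [|h /=]; first exact: (word_eq_cancel R [::] s b [::]).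
  by rewrite gen_conj addn0 addnn odd_double.
apply: drop_trivial => [|h]; last exact: odd_count_relator.
by have := word_eq_relator [::] [::] Rr; rewrite cats0.
Qed.

(** The parity of the number of crossings of a wall depends only on the value
    of the word. *)
Lemma odd_count_eval u v t : eval u = eval v ->
  odd (count_mem t (reflections u)) = odd (count_mem t (reflections v)).
Proof.
have sgnK : cancel (map (fun s : S => (s, false))) unzip1.
  by move=> w; rewrite /unzip1 -map_comp map_id.
move=> e; rewrite -(sgnK u) -(sgnK v); apply: odd_count_word_eq.
by apply/(proj2 prm); rewrite !word_eval_unsigned !sgnK.
Qed.

(** Every element is a product of generators, so the minimum that defines the
    length is attained. *)
Lemma lengthP x : is_word_length S x (length S x) /\
  forall l, is_word_length S x l -> (length S x <= l)%N.
Proof.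
rewrite /length; apply: (xgetPex 0%N (P := [set k | is_word_length S x k /\
  forall l, is_word_length S x l -> (k <= l)%N]%classic)).
have ex : exists k, `[< is_word_length S x k >].
  by have [u <-] := eval_surj x; exists (size u); apply/asboolP; exists u.
case: (ex_minnP ex) => k /asboolP xk mink; exists k; split=> // l xl.
by apply: mink; apply/asboolP.
Qed.

Lemma length_eval u : (length S (eval u) <= size u)%N.
Proof. by apply: (lengthP _).2; exists u. Qed.

Lemma reduced_word_exists x :
  {u : seq S | size u = length S x /\ eval u = x}.
Proof. by apply: cid; have [[u ?] _] := lengthP x; exists u. Qed.

(** A word of minimal length with value x. *)
Definition reduced_word x : seq S := sval (reduced_word_exists x).

Lemma size_reduced_word x : size (reduced_word x) = length S x.
Proof. exact: (svalP (reduced_word_exists x)).1. Qed.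

Lemma eval_reduced_word x : eval (reduced_word x) = x.
Proof. exact: (svalP (reduced_word_exists x)).2. Qed.

(** The exchange property: multiplying by the i-th reflection of a word
    deletes its i-th letter. *)
Lemma reflection_delete u t : t \in reflections u ->
  exists2 v : seq S, (size v < size u)%N & eval u = t * eval v.
Proof.
elim: u t => //= s u IHu t; rewrite inE => /predU1P[-> | /mapP[h hu ->]].
  by exists u => //; rewrite eval_cons.
have [v lt_vu ev] := IHu h hu; exists (s :: v) => //.
by rewrite !eval_cons ev conjgE !gen_inv -!mulgA gen_mulK.
Qed.

Lemma shorten_repeated u : ~~ uniq (reflections u) ->
  exists2 v : seq S, (size v < size u)%N & eval v = eval u.
Proof.
elim: u => //= s u IHu.
rewrite map_inj_uniq; last exact: conjg_inj.
rewrite negb_and negbK => /orP[/mapP[h hu e] | /IHu[v lt_vu ev]]; last first.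
  by exists (s :: v); rewrite ?eval_cons ?ev.
have {}e : h = val s by apply: (@conjg_inj _ (val s)^-1); rewrite -e gen_conj.
have [v lt_vu ev] := reflection_delete hu.
by exists v; [apply: ltnW | rewrite eval_cons ev e gen_mulK].
Qed.

(** The reflections whose walls separate 1 from x. *)
Definition inversions x : seq W := reflections (reduced_word x).

Lemma size_inversions x : size (inversions x) = length S x.
Proof. by rewrite size_reflections size_reduced_word. Qed.

Lemma inversions_uniq x : uniq (inversions x).
Proof.
apply/idPn => /shorten_repeated[v]; rewrite eval_reduced_word size_reduced_word.
by move=> lt_v ev; move: (length_eval v); rewrite ev leqNgt lt_v.
Qed.

Lemma mem_inversions_eval u t :
  (t \in inversions (eval u)) = odd (count_mem t (reflections u)).
Proof.
rewrite -(odd_count_eval t (eval_reduced_word (eval u))).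
by rewrite -/(inversions _) count_uniq_mem ?inversions_uniq ?oddb.
Qed.

(** A wall separates 1 from x y if and only if it separates either 1 from x or
    x from x y, but not both. *)
Lemma mem_inversionsM x y t :
  (t \in inversions (x * y)) = (t \in inversions x) (+) (t ^ x \in inversions y).
Proof.
have [[u <-] [v <-]] := (eval_surj x, eval_surj y).
by rewrite -eval_cat !mem_inversions_eval count_reflections_cat oddD.
Qed.

Lemma mem_inversions1 t : (t \in inversions 1) = false.
Proof.
by rewrite -(eval_nil S) mem_inversions_eval.
Qed.

Lemma mem_inversions_gen s t : (t \in inversions (val s)) = (t == val s).
Proof.
rewrite -[X in inversions X]mulg1.
rewrite -(eval_nil S) -(eval_cons s [::]).
by rewrite mem_inversions_eval /= addn0 oddb eq_sym.
Qed.

Lemma mem_conj_inversions x y t :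
  (t \in [seq h ^ x^-1 | h <- inversions y]) = (t ^ x \in inversions y).
Proof.
by rewrite -[t in LHS](conjgK x) (mem_map (@conjg_inj _ _)).
Qed.

(** If xy is reduced, no wall separates x from both 1 and x y. *)
Lemma reduced_disjoint x y t : length S (x * y) = (length S x + length S y)%N ->
  t \in inversions x -> t ^ x \in inversions y -> False.
Proof.
(* If t is crossed twice, the |xy| walls separating 1 from x y lie in the list
   of all |x| + |y| crossings, from which one occurrence of t can be removed. *)
move=> e tx ty; pose r := rem t (inversions x) ++ [seq h ^ x^-1 | h <- inversions y].
have sub : {subset inversions (x * y) <= r}.
  move=> h hxy; rewrite mem_cat mem_conj_inversions.
  rewrite mem_rem_uniq ?inversions_uniq // inE.
  move: hxy; rewrite mem_inversionsM.
  by case: eqP => [-> | _] /=; [rewrite tx ty | case: (h \in _)].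
have := uniq_leq_size (inversions_uniq _) sub.
rewrite size_cat size_map size_rem // !size_inversions e.
rewrite -size_inversions; case: (inversions x) tx => //= a l _.
by rewrite ltnn.
Qed.

Lemma length1 : length S 1 = 0%N.
Proof.
rewrite -size_inversions; case: (inversions 1) (@mem_inversions1) => //= t l /(_ t).
by rewrite mem_head.
Qed.

Lemma length_gen s : length S (val s) = 1%N.
Proof.
have sub : {subset inversions (val s) <= [:: val s]}.
  by move=> t; rewrite mem_inversions_gen inE.
apply/eqP; rewrite eqn_leq -size_inversions.
rewrite (uniq_leq_size (inversions_uniq _) sub).
by have := mem_inversions_gen s (val s); rewrite eqxx; case: inversions.
Qed.

Lemma length_genM_le s x : (length S (val s * x) <= (length S x).+1)%N.
Proof.
rewrite -[x in val s * x]eval_reduced_word -eval_cons.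
rewrite -[length S x]size_reduced_word; exact: (length_eval (s :: _)).
Qed.

Lemma inversion_descent s x : val s \in inversions x ->
  length S x = (length S (val s * x)).+1.
Proof.
move=> /reflection_delete[v]; rewrite eval_reduced_word size_reduced_word => lt_v e.
have e' : val s * x = eval v by rewrite e gen_mulK.
apply/eqP; rewrite eqn_leq e' (leq_ltn_trans (length_eval v) lt_v) andbT.
by rewrite -[x in length S x](gen_mulK s) e' length_genM_le.
Qed.

Lemma length_genM s x : length S (val s * x) = (length S x).+1 \/
  length S x = (length S (val s * x)).+1.
Proof.
case: (boolP (val s \in inversions x)) => [/inversion_descent|nsx]; [by right|].
left; have := @inversion_descent s (val s * x); rewrite gen_mulK; apply.
rewrite mem_inversionsM mem_inversions_gen eqxx conjgE gen_inv gen_mul mulg1.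
by rewrite (negbTE nsx).
Qed.

Lemma length_decompose x : x <> 1 ->
  exists s, length S x = (length S (val s * x)).+1.
Proof.
move=> x1; have := eval_reduced_word x; have := size_reduced_word x.
case: (reduced_word x) => [_ | s u sz e].
  by rewrite eval_nil => /esym.
exists s; case: (length_genM s x) => // e'; move: (length_eval u).
have -> : eval u = val s * x by rewrite -e eval_cons gen_mulK.
by rewrite e' -sz /= => /ltnW; rewrite ltnn.
Qed.

End CoxeterGroup.

(** * Alternating sequences of signs *)

Section Alternating.
Implicit Types (a b : nat -> bool) (n : nat).

(** The n + 1 values a 0, ..., a n alternate. *)
Definition alternating n a := all (fun i => a i != a i.+1) (iota 0 n).

Lemma alternatingP n a :
  reflect (forall i, (i < n)%N -> a i != a i.+1) (alternating n a).
Proof.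
apply: (iffP allP) => [alt_a i lt_in | alt_a i].
  by apply: alt_a; rewrite mem_iota.
by rewrite mem_iota; apply: alt_a.
Qed.

Lemma alternatingS n a :
  alternating n.+1 a = (a 0%N != a 1%N) && alternating n (fun i => a i.+1).
Proof. by rewrite /alternating /= (iotaDl 1 0) all_map. Qed.

Lemma eq_alternating n a b : (forall i, (i <= n)%N -> a i = b i) ->
  alternating n a = alternating n b.
Proof.
move=> ab; apply: eq_in_all => i; rewrite mem_iota => /= lt_in.
by rewrite (ab i (ltnW lt_in)) (ab i.+1 lt_in).
Qed.

Lemma alternating_addb n a c :
  alternating n (fun i => c (+) a i) = alternating n a.
Proof. by apply: eq_all => i; rewrite (inj_eq (@addbI c)). Qed.

(** The sequence [fun i => a (bump j i)] is a with its j-th term deleted. *)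
Lemma alternating_sum (A : comNzRingType) n a :
  (\sum_(j < n.+2) (-1) ^+ j * (alternating n (fun i => a (bump j i)))%:R
   = (1 + (-1) ^+ n.+1) * (alternating n.+1 a)%:R :> A)%R.
Proof.
elim: n a => [|n IHn] a.
  by rewrite !big_ord_recl big_ord0 /alternating /= expr0 expr1; ring.
have := IHn (fun i => a i.+1).
rewrite big_ord_recl [in X in _ -> X]big_ord_recl [in X in _ -> X]big_ord_recl.
(* T collects the terms of the induction hypothesis with j >= 1, and U those of
   the goal with j >= 2: deleting a later term leaves a 0 and a 1 in place. *)
set T := (\sum_(i < n.+1) _)%R; set U := (\sum_(i < n.+1) _)%R.
have -> : U = (- ((a 0%N != a 1%N)%:R * T))%R.
  rewrite /U /T -mulNr mulr_sumr; apply: eq_bigr => j _.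
  rewrite alternatingS.
  rewrite (eq_alternating (b := fun i => a (bump (lift ord0 j) i).+1)); last first.
    by move=> i _; rewrite /bump /= addnS.
  by set q := alternating _ _; rewrite -mulnb natrM /bump /= !exprS; ring.
rewrite !alternatingS /bump /=.
set c := alternating n _; move: (a 0%N) (a 1%N) (a 2%N) => a0 a1 a2.
rewrite !expr0 !exprS.
move=> /(canRL (addKr _)) ->.
by case: a0 a1 a2 c => [] [] [] []; rewrite /=; ring.
Qed.

End Alternating.

(** * Cochains in terms of sequences *)

Section Simplices.
Variable W : groupType.
Implicit Types (f g : nat -> W) (n i j k : nat).

(** Tuples are handled through sequences [nat -> W], of which only the first n
    entries matter. *)
Definition ftuple n f : n.-tuple W := [tuple f i | i < n].

Lemma nth_ftuple n f i : (i < n)%N -> nth 1 (ftuple n f) i = f i.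
Proof. by move=> lt_in; rewrite -(tnth_nth 1 _ (Ordinal lt_in)) tnth_mktuple. Qed.

Lemma ftuple_nth n (x : n.-tuple W) : ftuple n (nth 1 x) = x.
Proof. by apply: eq_from_tnth => i; rewrite tnth_mktuple -tnth_nth. Qed.

(** The faces of a tuple of n + 1 entries: the 0-th drops the first entry, and
    the (j+1)-th multiplies the entries j and j + 1. The last face, of index
    n + 1, drops the last entry: the product is then stored at index n, beyond
    the n entries that matter. *)
Definition face k f i : W :=
  if k is j.+1 then
    if (i < j)%N then f i else if i == j then f i * f i.+1 else f i.+1
  else f i.+1.

(** With trivial action, the coboundary is the alternating sum over the faces. *)
Lemma coboundaryE (A : comNzRingType) n (z : n.-tuple W -> A) f :
  coboundary (@trivial_action W A) z (ftuple n.+1 f)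
  = (\sum_(k < n.+2) (-1) ^+ k * z (ftuple n (face k f)))%R.
Proof.
rewrite big_ord_recl big_ord_recr /= expr0 mul1r addrA /coboundary.
congr (_ + _ + _)%R.
- rewrite /trivial_action; congr z; apply: eq_from_tnth => i.
  by rewrite !tnth_mktuple lift0.
- apply: eq_bigr => j _; rewrite -mulrzl intr_sign /bump /=; congr (_ * z _)%R.
  apply: eq_from_tnth => i; rewrite !tnth_mktuple lift0 lift_max.
  by rewrite -val_eqE.
- rewrite -mulrzl intr_sign /bump /=; congr (_ * z _)%R.
  by apply: eq_from_tnth => i; rewrite !tnth_mktuple lift_max add1n /= ltn_ord.
Qed.

Lemma cocycleP (A : comNzRingType) n (z : n.-tuple W -> A) :
  cocycle (@trivial_action W A) z <->
  forall f, (\sum_(k < n.+2) (-1) ^+ k * z (ftuple n (face k f)) = 0)%R.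
Proof.
split=> [cz f | cz]; first by rewrite -coboundaryE cz.
by apply/funext => x; rewrite -[x]ftuple_nth coboundaryE cz.
Qed.

(** The k-th chamber f 0 * ... * f (k-1) of the gallery of f. *)
Definition vertex f k : W := \prod_(i < k) f i.

Lemma vertex0 f : vertex f 0 = 1. Proof. exact: big_ord0. Qed.
Lemma vertexS f k : vertex f k.+1 = vertex f k * f k.
Proof. exact: big_ord_recr. Qed.

(** Up to left translation, the k-th face deletes the k-th chamber. *)
Lemma vertex_bump f k i :
  vertex f (bump k i) = vertex f (bump k 0) * vertex (face k f) i.
Proof.
elim: i => [|i IHi]; first by rewrite vertex0 mulg1.
rewrite vertexS mulgA -IHi; case: k {IHi} => [|k]; first by rewrite vertexS.
rewrite /bump /= ltnS; case: (ltngtP i k) => [lt_ik | lt_ki | ->] /=.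
- by rewrite vertexS.
- by rewrite !add1n vertexS.
- by rewrite !vertexS mulgA.
Qed.

End Simplices.

(** * The cocycle counting walls *)

Lemma neqb_or (b c : bool) : b != c -> b || c.
Proof. by case: b c => [] []. Qed.

Section CoxeterCocycle.
Variables (W : groupType) (S : set W) (m : S -> S -> nat).
Hypothesis mxm : coxeter_matrix m.
Hypothesis prm : presents (coxeter_relators m) (fun s : S => val s).
Implicit Types (f g : nat -> W) (s : S) (t x y : W).

Local Notation inv := (inversions mxm prm).

(** The wall of t separates g k from g (k+1) for all k < n. *)
Definition alternates n g t := alternating n (fun k => t \in inv (g k)).

(** The number of walls crossed at each of the n steps of g; for n > 0, such a
    wall separates 1 from exactly one of g 0 and g 1. *)
Definition crossings n g : nat :=
  count (alternates n g) (undup (inv (g 0%N) ++ inv (g 1%N))).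

(** For n > 0, any list without repetition that contains the walls separating
    g 0 from g 1 may be used to count. *)
Lemma crossingsE n g (r : seq W) : (0 < n)%N -> uniq r ->
    (forall t, (t \in inv (g 0%N)) != (t \in inv (g 1%N)) -> t \in r) ->
  crossings n g = count (alternates n g) r.
Proof.
move=> n_gt0 r_uniq r_sub; rewrite /crossings -!size_filter.
apply/perm_size/uniq_perm; rewrite ?filter_uniq ?undup_uniq // => t.
rewrite !mem_filter; case: (boolP (alternates n g t)) => //=.
move/alternatingP/(_ 0%N n_gt0) => sep.
by rewrite r_sub // mem_undup mem_cat neqb_or.
Qed.

Lemma eq_crossings n g1 g2 : (0 < n)%N ->
  (forall k, (k <= n)%N -> g1 k = g2 k) -> crossings n g1 = crossings n g2.
Proof.
move=> n_gt0 g12; rewrite /crossings !g12 //; apply: eq_count => t.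
by apply: eq_alternating => k le_kn; rewrite g12.
Qed.

Lemma crossings_mul n x g : (0 < n)%N ->
  crossings n (fun k => x * g k) = crossings n g.
Proof.
move=> n_gt0; set r := undup (inv (g 0%N) ++ inv (g 1%N)).
rewrite (@crossingsE _ _ [seq t ^ x^-1 | t <- r]) //; last first.
- move=> t; rewrite !mem_inversionsM (inj_eq (@addbI _)) => sep.
  rewrite -[t](conjgK x); apply: (map_f (fun h => h ^ x^-1)).
  by rewrite mem_undup mem_cat neqb_or.
- by rewrite map_inj_uniq ?undup_uniq //; apply: conjg_inj.
rewrite count_map; apply: eq_count => t /=.
rewrite /alternates -[RHS](alternating_addb n _ (t ^ x^-1 \in inv x)).
by apply: eq_alternating => k _; rewrite mem_inversionsM conjgKV.
Qed.

Lemma crossings_sum (A : comNzRingType) n g : (0 < n)%N ->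
  (\sum_(k < n.+2) (-1) ^+ k * (crossings n (fun i => g (bump k i)))%:R
   = (1 + (-1) ^+ n.+1) * (crossings n.+1 g)%:R :> A)%R.
Proof.
(* The first two chambers of every face are among g 0, g 1 and g 2, so all the
   counts can be taken over the same list r. *)
move=> n_gt0; pose r := undup (inv (g 0%N) ++ inv (g 1%N) ++ inv (g 2%N)).
have countE k h : ((count (alternates k h) r)%:R
    = \sum_(t <- r) (alternates k h t)%:R :> A)%R.
  rewrite -sum1_count natr_sum big_mkcond; apply: eq_bigr => t _.
  by case: (alternates _ _ _).
have sub i t : (i < 3)%N -> t \in inv (g i) -> t \in r.
  rewrite mem_undup !mem_cat.
  by case: i => [|[|[|//]]] _ ->; rewrite ?orbT.
rewrite (@crossingsE _ g r) ?undup_uniq //; last first.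
  by move=> t /neqb_or/orP[]; apply: sub.
rewrite countE mulr_sumr.
rewrite (eq_bigr (fun k : 'I__ => \sum_(t <- r)
  (-1) ^+ k * (alternates n (fun i => g (bump k i)) t)%:R)%R) => [|k _].
  by rewrite exchange_big; apply: eq_bigr => t _; apply: alternating_sum.
rewrite -mulr_sumr -countE (@crossingsE _ _ r) ?undup_uniq // => t.
have b3 i : (i < 2)%N -> (bump k i < 3)%N.
  by rewrite /bump -addnS => i2; apply: (leq_add (leq_b1 _) i2).
by case/neqb_or/orP; apply/sub/b3.
Qed.

(** The cochain counting, in A, the walls crossed at each step of the gallery
    of x. *)
Definition coxeter_cochain (A : comNzRingType) n (x : n.-tuple W) : A :=
  (crossings n (vertex (nth 1%g x)))%:R%R.

Lemma coxeter_cochainE (A : comNzRingType) n f : (0 < n)%N ->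
  coxeter_cochain A (ftuple n f) = (crossings n (vertex f))%:R%R.
Proof.
move=> n_gt0; congr (_%:R)%R; apply: eq_crossings => // k le_kn.
apply: eq_bigr => i _; rewrite nth_ftuple //.
exact: leq_trans (ltn_ord i) le_kn.
Qed.

Lemma coxeter_cochain_cocycle (A : comNzRingType) n : (0 < n)%N ->
  (1 + (-1) ^+ n.+1 = 0 :> A)%R ->
  cocycle (@trivial_action W A) (@coxeter_cochain A n).
Proof.
move=> n_gt0 sgn0; apply/cocycleP => f.
rewrite (eq_bigr (fun k : 'I_n.+2 =>
  (-1) ^+ k * (crossings n (fun i => vertex f (bump k i)))%:R)%R) => [|k _].
  by rewrite crossings_sum // sgn0 mul0r.
rewrite coxeter_cochainE // -(crossings_mul (vertex f (bump k 0))) //.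
by congr (_ * (_%:R))%R; apply: eq_crossings => // i _; rewrite -vertex_bump.
Qed.

Lemma coxeter_cochain_reduced (A : comNzRingType) n :
  vanishes_on_reduced S (@coxeter_cochain A n).
Proof.
move=> n_ge2 x [i [j [ij red]]].
rewrite /coxeter_cochain /crossings (eq_count (a2 := pred0)) ?count_pred0 // => t.
apply/negbTE/negP => /alternatingP alt.
have := alt i (ltn_ord i); have := alt i.+1; rewrite -ij => /(_ (ltn_ord j)).
rewrite ij !vertexS !mem_inversionsM -ij -!tnth_nth.
set g := vertex _ _; rewrite conjgM.
have := @reduced_disjoint _ _ _ mxm prm _ _ (t ^ g) red.
do 3!case: (_ \in _) => //=; exact.
Qed.

(** The gallery 1, s, 1, s, ... crosses the wall of s at every step, and no
    other wall. *)
Lemma coxeter_cochain_normalized (A : comNzRingType) n : (0 < n)%N ->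
  normalized S (@coxeter_cochain A n).
Proof.
move=> n_gt0 r Sr; have [s ->] : exists s : S, r = val s.
  by exists (exist _ r (mem_set Sr)).
rewrite -[[tuple _ | _ < _]]/(ftuple n (fun=> val s)) coxeter_cochainE //.
rewrite (@crossingsE _ _ [:: val s]) //; last first.
  move=> t; rewrite vertexS vertex0 mul1g mem_inversions1 mem_inversions_gen inE.
  by move/neqb_or.
rewrite /= addn0 (_ : alternates _ _ _ = true) //.
apply/alternatingP => i _; rewrite vertexS.
suff -> : vertex (fun=> val s) i * val s = val s * vertex (fun=> val s) i.
  rewrite mem_inversionsM mem_inversions_gen eqxx /= conjgE (gen_mul mxm prm).
  by rewrite mulg1 (gen_inv mxm prm); case: (_ \in _).
elim: i => [|i IHi]; first by rewrite vertex0 mulg1 mul1g.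
by rewrite !vertexS {1}IHi mulgA.
Qed.

(** * Uniqueness *)

Section Uniqueness.
Variables (A : comNzRingType) (n : nat) (z : n.-tuple W -> A).
Hypothesis n_gt0 : (0 < n)%N.
Hypothesis z_cocycle : cocycle (@trivial_action W A) z.
Hypothesis z_reduced : vanishes_on_reduced S z.
Hypothesis z_gen : forall s, z (ftuple n (fun=> val s)) = 0%R.

Lemma vanish_reduced f i : (i.+1 < n)%N ->
  length S (f i * f i.+1) = (length S (f i) + length S (f i.+1))%N ->
  z (ftuple n f) = 0%R.
Proof.
move=> lt_in red; apply: z_reduced; first exact: leq_trans lt_in.
by exists (Ordinal (ltnW lt_in)), (Ordinal lt_in); rewrite !tnth_mktuple.
Qed.

(** For n >= 2, the entry 1 is reduced next to any other entry; for n = 1, the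
    coboundary at (1, 1) is z (1). *)
Lemma vanish_one f i : (i < n)%N -> f i = 1 -> z (ftuple n f) = 0%R.
Proof.
move=> lt_in fi.
have [n1 | n2] : n = 1%N \/ (1 < n)%N by case: (n) n_gt0 => [|[|]]; auto.
  move: lt_in; rewrite [in (i < _)%N]n1; case: i fi => // f0 _.
  have := (cocycleP z).1 z_cocycle (fun=> 1).
  have e k : z (ftuple n (face k (fun=> 1))) = z (ftuple n f).
    congr z; apply: eq_from_tnth => i; rewrite !tnth_mktuple.
    have -> : i = 0%N :> nat.
      by apply/eqP; rewrite -leqn0 -ltnS (leq_trans (ltn_ord i)) ?n1.
    by rewrite f0 /face; case: k => [|[|k]] //=; rewrite ?mulg1.
  under eq_bigr => k _ do rewrite e.
  by move: (z _) => c; rewrite n1 !big_ord_recl big_ord0 /= /bump /= => <-; ring.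
case: i lt_in fi => [|i] lt_in fi.
  by apply: (@vanish_reduced f 0) => //; rewrite fi mul1g (length1 mxm prm).
by apply: (@vanish_reduced f i) => //; rewrite fi mulg1 (length1 mxm prm) addn0.
Qed.

(** In the coboundary at (s, ..., s, y, ...), with k + 1 copies of s and s y
    reduced, only the faces of index 0, k + 1 and k + 2 can contribute: those in
    between contain s s = 1, the later ones the reduced pair s, y. *)
Lemma vanish_step k s f : (k < n)%N ->
    (forall i, (i <= k)%N -> f i = val s) ->
    length S (val s * f k.+1) = (length S (f k.+1)).+1 ->
    z (ftuple n (face 0 f)) = 0%R ->
    z (ftuple n (face k.+2 f)) = 0%R ->
  z (ftuple n (face k.+1 f)) = 0%R.
Proof.
move=> lt_kn fs red z0 zk.
have := (cocycleP z).1 z_cocycle f.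
have lt_k2 : (k.+1 < n.+2)%N by rewrite ltnS ltnW.
rewrite (bigD1 (Ordinal lt_k2)) //= big1 ?addr0 => [e|j].
  by rewrite -[LHS](signrMK k.+1) e mulr0.
rewrite -val_eqE /= => ne_jk.
case: j ne_jk => [[|j] /= lt_jn ne_jk]; first by rewrite z0 mulr0.
case: (ltngtP j k) ne_jk => [lt_jk _ | lt_kj _ | ->]; last by rewrite eqxx.
  rewrite (@vanish_one _ j) ?mulr0 ?(ltn_trans lt_jk) //= ltnn eqxx.
  by rewrite !fs ?(ltnW lt_jk) // (gen_mul mxm prm).
have [lt_jk1 | lt_k1j | ->] := ltngtP j k.+1; last by rewrite zk mulr0.
  by move: (leq_ltn_trans lt_kj lt_jk1); rewrite ltnn.
rewrite (@vanish_reduced _ k) ?mulr0 //=.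
  by apply: leq_trans lt_k1j _; rewrite -ltnS.
by rewrite lt_k1j (ltn_trans (ltnSn _) lt_k1j) fs // red (length_gen mxm prm) add1n.
Qed.

Lemma eq_ftuple f g : (forall i, (i < n)%N -> f i = g i) ->
  ftuple n f = ftuple n g.
Proof. by move=> fg; apply: eq_from_tnth => i; rewrite !tnth_mktuple fg. Qed.

(** The previous lemma, read from the face of index k + 1: f starts with k
    copies of s, and its next entry has s as a left descent. *)
Lemma vanish_descent k s f : (k < n)%N ->
    (forall i, (i < k)%N -> f i = val s) ->
    length S (f k) = (length S (val s * f k)).+1 ->
    z (ftuple n (fun i => if i == k then val s * f k else f i)) = 0%R ->
    (forall g, (forall i, (i <= k)%N -> g i = val s) ->
      z (ftuple n g) = 0%R) ->
  z (ftuple n f) = 0%R.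
Proof.
move=> lt_kn fs red z0 zs.
(* F is (s, ..., s, s * f k, f (k+1), ...) with k + 1 copies of s. *)
pose F i :=
  if (i <= k)%N then val s else if i == k.+1 then val s * f k else f i.-1.
have Fs i : (i <= k)%N -> F i = val s by rewrite /F => ->.
have Fk : F k.+1 = val s * f k by rewrite /F ltnn eqxx.
have -> : ftuple n f = ftuple n (face k.+1 F).
  apply: eq_ftuple => i _ /=; case: (ltngtP i k) => [lt_ik | lt_ki | ->].
  - by rewrite Fs ?fs // ltnW.
  - by rewrite /F ltnNge (ltnW lt_ki) /= eqSS gtn_eqF.
  - by rewrite Fs // Fk (gen_mulK mxm prm).
apply: (vanish_step lt_kn Fs).
- by rewrite Fk (gen_mulK mxm prm).
- rewrite -[RHS]z0; congr z; apply: eq_ftuple => i _ /=.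
  by rewrite /F eqSS; case: (ltngtP i k) => // /fs.
- by apply: zs => i le_ik /=; rewrite ltnS le_ik Fs.
Qed.

(** Descending induction on the number k + 1 of leading copies of s. *)
Lemma vanish_prefix k s f : (k < n)%N ->
  (forall i, (i <= k)%N -> f i = val s) -> z (ftuple n f) = 0%R.
Proof.
move=> lt_kn; have [d] := ubnP (n - k.+1); elim: d k lt_kn f => // d IHd k lt_kn f.
rewrite ltnS => le_d fs; have [lt_k1n | le_nk1] := ltnP k.+1 n; last first.
  rewrite (@eq_ftuple _ (fun=> val s)) ?z_gen // => i lt_in.
  by rewrite fs // -ltnS (leq_trans lt_in).
have fk := fs k (leqnn k).
case: (length_genM mxm prm s (f k.+1)) => red.
  by apply: (@vanish_reduced _ k); rewrite // fk (length_gen mxm prm) add1n.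
apply: (@vanish_descent k.+1 s) => // [|g gs].
  apply: (@vanish_reduced _ k); rewrite // eqxx (ltn_eqF (ltnSn k)) fk.
  by rewrite (gen_mulK mxm prm) (length_gen mxm prm) add1n.
by apply: (IHd k.+1) => //; apply: leq_trans le_d; rewrite -subSn // subSS.
Qed.

Lemma vanish_everywhere (x : n.-tuple W) : z x = 0%R.
Proof.
rewrite -[x]ftuple_nth; move: (nth 1 x) => f.
have [d] := ubnP (length S (f 0%N)); elim: d f => // d IHd f; rewrite ltnS => le_d.
case: (pselect (f 0%N = 1)) => [/(vanish_one n_gt0) // | f0].
have [s red] := length_decompose mxm prm f0.
apply: (@vanish_descent 0 s) => // [|g gs].
  by apply: IHd; rewrite /= -red.
exact: (@vanish_prefix 0 s).
Qed.

End Uniqueness.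

Lemma coxeter_cocycle_unique (A : comNzRingType) n (z1 z2 : n.-tuple W -> A) :
    (0 < n)%N ->
    cocycle (@trivial_action W A) z1 -> cocycle (@trivial_action W A) z2 ->
    vanishes_on_reduced S z1 -> vanishes_on_reduced S z2 ->
    normalized S z1 -> normalized S z2 ->
  z1 = z2.
Proof.
move=> n_gt0 /cocycleP c1 /cocycleP c2 r1 r2 g1 g2; apply/funext => x.
apply/eqP; rewrite -subr_eq0; apply/eqP.
pose z (y : n.-tuple W) := (z1 y - z2 y)%R.
apply: (@vanish_everywhere A n z) => //.
- apply/cocycleP => f; rewrite /z; under eq_bigr => k _ do rewrite mulrBr.
  by rewrite sumrB c1 c2 subrr.
- by move=> n_ge2 y red; rewrite /z (r1 n_ge2 y red) (r2 n_ge2 y red) subrr.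
- by move=> s; rewrite /z g1 ?g2 ?subrr //; apply: set_mem (valP s).
Qed.

(** The hypothesis on A means that n is even or that 2 = 0 in A. *)
Lemma coxeter_cocycle_exists_unique (A : comNzRingType) n : (0 < n)%N ->
    (1 + (-1) ^+ n.+1 = 0 :> A)%R ->
  exists! e : n.-tuple W -> A,
    [/\ cocycle (@trivial_action W A) e,
        vanishes_on_reduced S e & normalized S e].
Proof.
move=> n_gt0 sgn0; exists (@coxeter_cochain A n); split=> [|z [cz rz gz]].
  split; [exact: coxeter_cochain_cocycle | exact: coxeter_cochain_reduced
    | exact: coxeter_cochain_normalized].
apply: coxeter_cocycle_unique => //; [exact: coxeter_cochain_cocycle
  | exact: coxeter_cochain_reduced | exact: coxeter_cochain_normalized].
Qed.

End CoxeterCocycle.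

Theorem theorem1p1 (W : groupType) (S : set W) (hW : coxeter_group S)
    (n : nat) (hn : (1 <= n)%N) :
  (~~ odd n ->
     exists! e : n.-tuple W -> int,
       [/\ cocycle (@trivial_action W int) e,
           vanishes_on_reduced S e
         & normalized S e]) /\
  (odd n ->
     exists! e : n.-tuple W -> 'F_2,
       [/\ cocycle (@trivial_action W 'F_2) e,
           vanishes_on_reduced S e
         & normalized S e]).
Proof.
have [m [mxm prm]] := hW.
split=> [n_even | n_odd]; apply: (coxeter_cocycle_exists_unique mxm prm hn).
  by rewrite -signr_odd /= n_even expr1 subrr.
by rewrite -signr_odd /= n_odd expr0; apply: val_inj.
Qed.
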